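(* Assume continuity and uniform boundedness, positivity, and IV relevance (as defined in the context). For every $a\in\mathring{\mathcal A}$ let $\pi_a(Z,L):=p_{A\mid Z,L}(a\mid Z,L)/p_{A\mid L}(a\mid L)$, and suppose that $\kappa_{\pi_a}^o(\cdot,l)$ is equicontinuous at $a$, uniformly over $l\in\mathcal L$, i.e. for any $\epsilon>0$ there exists $r_0>0$ such that $|\kappa_{\pi_a}^o(a',l)-\kappa_{\pi_a}^o(a,l)|\le\epsilon$ for all $l\in\mathcal L$ and $a'\in\mathcal B(a,r_0)$. Then, for any compact subset $\mathcal A_c\subseteq\mathring{\mathcal A}$, there exists a finite collection of open intervals $\{\mathcal B(a_m,h_m)\}_{m=1}^M$ such that $\mathcal A_c\subseteq\bigcup_{m=1}^M\mathcal B(a_m,h_m)$. Moreover, for each $m=1,\dots,M$, the function $\pi_{a_m}(Z,L)$ serves as a uniform regular weighting function (URWF) for $\mathcal B(a_m,h_m)$.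
   Context: Setting. $A$ is a continuous treatment whose support $\mathcal A\subseteq\mathbb R$ is closed, with interior $\mathring{\mathcal A}$; $Z\in\mathcal Z\subseteq\mathbb R^{d_Z}$ is an instrumental variable (IV, discrete or continuous); $L\in\mathcal L\subseteq\mathbb R^{d_L}$ are observed confounders. $p_{A\mid Z,L}$, $p_{A\mid L}$, $p_{Z\mid A,L}$, $p_{Z\mid L}$ are conditional densities. $\mathcal B(a,h):=(a-h,a+h)$. Throughout, $p_{A\mid L}(a\mid L)>0$ for all $a\in\mathring{\mathcal A}$ almost surely. Assumptions. Continuity and uniform boundedness: for all $a\in\mathring{\mathcal A}$, $p_{A\mid Z,L}(a\mid Z,L)$ is continuous with respect to $a$ almost surely, and there exists $M(a)$ with $p_{A\mid Z,L}(a\mid Z,L)\le M(a)$ almost surely. Positivity: for any $a\in\mathring{\mathcal A}$ there is $\epsilon_1(a)>0$ with $p_{A\mid L}(a\mid L)\ge\epsilon_1(a)$ almost surely. IV relevance: with $\chi^2[q(\cdot)\|p(\cdot)]:=\int(\frac{q(z)}{p(z)}-1)^2p(z)\,\mathrm dz$, for any $a\in\mathring{\mathcal A}$ there is $\epsilon_2(a)>0$ with $\chi^2[p_{Z\mid A,L}(\cdot\mid a,L)\|p_{Z\mid L}(\cdot\mid L)]\ge\epsilon_2(a)$ almost surely. Definitions. $\kappa_\pi^o(A,L):=\mathbb E[\pi(Z,L)\mid A,L]-\mathbb E[\pi(Z,L)\mid L]$. A measurable $\pi:\mathcal Z\times\mathcal L\to\mathbb R$ is a URWF for $\mathcal N\subseteq\mathring{\mathcal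 A}$ if it is uniformly bounded and there is a constant $\epsilon_\pi(\mathcal N)>0$ such that, for all $a\in\mathcal N$, $|\kappa_\pi^o(a,L)|\ge\epsilon_\pi(\mathcal N)$ almost surely. *)

(* Defs.v *)
From HB Require Import structures.
From mathcomp Require Import all_boot all_order all_algebra.
From mathcomp Require Import all_classical all_reals all_analysis.
From mathcomp Require Import measurable_realfun.

Set Implicit Arguments.
Unset Strict Implicit.
Unset Printing Implicit Defensive.

Import Order.TTheory GRing.Theory Num.Theory.
Import numFieldNormedType.Exports.

Local Open Scope classical_set_scope.
Local Open Scope ring_scope.

Definition openB (R : realType) (a h : R) : set R := `]a - h, a + h[%classic.

(* Topological support of the law of a real random variable; it is closed. *)
Definition law_support d (Omega : measurableType d) (R : realType)
    (P : probability Omega R) (A : {RV P >-> R}) : set R :=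
  [set a | forall e, 0 < e -> (0 < distribution P A (openB a e))%E].

(* [p x y] is a conditional density at [x] of [X] given [Y = y], with respect
   to the restriction of the base measure [mu] to [D]: the joint law of (X, Y)
   is p(x | y) mu(dx) P_Y(dy). *)
Definition cond_density d (Omega : measurableType d) (R : realType)
    (P : probability Omega R) dX (TX : measurableType dX)
    dY (TY : measurableType dY) (mu : set TX -> \bar R) (D : set TX)
    (X : Omega -> TX) (Y : Omega -> TY) (p : TX -> TY -> R) : Prop :=
  [/\ measurable_fun [set: TX * TY] (fun xy => p xy.1 xy.2),
      (forall x y, 0 <= p x y) &
      forall S : set (TX * TY), measurable S ->
        P [set w | S (X w, Y w)] =
        (\int[P]_w \int[mu]_(x in [set x | D x /\ S (x, Y w)])
           (p x (Y w))%:E)%E].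

(* The ratio q / p is 0 wherever p vanishes. *)
Definition chi2 d (T : measurableType d) (R : realType)
    (mu : {measure set T -> \bar R}) (D : set T) (q p : T -> R) : \bar R :=
  (\int[mu]_(z in D) (((q z / p z - 1) ^+ 2 * p z)%:E))%E.

Section conditional_laws.
Context d (Omega : measurableType d) (R : realType) (P : probability Omega R).
Context dZ (TZ : measurableType dZ) dL (TL : measurableType dL).
Variables (A : {RV P >-> R}) (Z : {RV P >-> TZ}) (L : {RV P >-> TL}).
Variables (nu : {measure set TZ -> \bar R}) (calZ : set TZ) (calL : set TL).
(* [pA_ZL] and [pZ_L] are conditional densities of A given (Z, L) and of Z
   given L; the base measure [nu] of the latter is Lebesgue measure for a
   continuous Z and a counting measure for a discrete one. *)
Variables (pA_ZL : R -> TZ * TL -> R) (pZ_L : TZ -> TL -> R).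

(* The assumptions constrain the conditional densities at each fixed [a], a
   null event, so their versions must agree at every [a]: the densities of A
   given L and of Z given (A, L) are the ones that the law of total
   probability and Bayes' rule produce from the two above. They are conditional
   densities in the sense of [cond_density]: see [cond_density_A_L] and
   [cond_density_Z_AL]. *)
Definition pA_L (a : R) (l : TL) : R :=
  (\int[nu]_(z in calZ) (pA_ZL a (z, l) * pZ_L z l))%R.

Definition pZ_AL (z : TZ) (al : R * TL) : R :=
  pA_ZL al.1 (z, al.2) * pZ_L z al.2 / pA_L al.1 al.2.

(* E[g(Z, L) | A = a, L = l] and E[g(Z, L) | L = l], in the versions given by
   the conditional densities, which are defined at every (a, l). *)
Definition condE_AL (g : TZ * TL -> R) (a : R) (l : TL) : R :=
  (\int[nu]_(z in calZ) (g (z, l) * pZ_AL z (a, l)))%R.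

Definition condE_L (g : TZ * TL -> R) (l : TL) : R :=
  (\int[nu]_(z in calZ) (g (z, l) * pZ_L z l))%R.

Definition kappa (g : TZ * TL -> R) (a : R) (l : TL) : R :=
  condE_AL g a l - condE_L g l.

(* Densities are only determined, and assumed bounded, almost surely; hence
   uniform boundedness of a weighting function is that of g(Z, L) up to a null
   event. *)
Definition URWF (N : set R) (g : TZ * TL -> R) : Prop :=
  [/\ N `<=` interior (law_support A),
      measurable_fun (calZ `*` calL) g,
      (exists C : R, {ae P, forall w, `|g (Z w, L w)| <= C}) &
      exists2 eps : R, 0 < eps &
        forall a, N a -> {ae P, forall w, eps <= `|kappa g a (L w)|}].

Definition pi_ (a : R) (zl : TZ * TL) : R := pA_ZL a zl / pA_L a zl.2.

End conditional_laws.

Import HBNNSimple.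
Local Open Scope ereal_scope.

Lemma ge0_integral_transport (R : realType) d1 (T1 : measurableType d1) d2 (T2 : measurableType d2)
  d (T : measurableType d) (m1 : {measure set T1 -> \bar R})
  (m2 : {measure set T2 -> \bar R}) (f1 : T1 -> T) (f2 : T2 -> T) (h : T2 -> R) :
  measurable_fun [set: T1] f1 -> measurable_fun [set: T2] f2 -> measurable_fun [set: T2] h ->
  (forall y, (0 <= h y)%R) ->
  (forall S, measurable S -> m1 (f1 @^-1` S) = \int[m2]_y ((\1_S (f2 y))%:E * (h y)%:E)) ->
  forall G : T -> \bar R, measurable_fun [set: T] G -> (forall x, 0 <= G x) ->
  \int[m1]_x G (f1 x) = \int[m2]_y (G (f2 y) * (h y)%:E).
Proof.
move=> mf1 mf2 mh h0 H G mG G0.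
pose g_ := nnsfun_approx measurableT mG.
have key (g : {nnsfun T >-> R}) :
    \int[m1]_x (g (f1 x))%:E = \int[m2]_y ((g (f2 y))%:E * (h y)%:E).
  under eq_integral do rewrite fimfunE -fsumEFin//.
  rewrite ge0_integral_fsum//; last 2 first.
    - move=> r; apply/measurable_EFinP; apply: measurable_funM => //.
      exact: measurableT_comp.
    - by move=> r z _; rewrite EFinM nnfun_muleindic_ge0.
  under [RHS]eq_integral.
    move=> y _; rewrite fimfunE -fsumEFin// ge0_mule_fsuml; last first.
      by move=> r; rewrite EFinM nnfun_muleindic_ge0.
    over.
  rewrite /= ge0_integral_fsum//; last 2 first.
    - move=> r; apply: emeasurable_funM; apply/measurable_EFinP => //.
      by apply: measurable_funM => //; exact: measurableT_comp.
    - by move=> r z _; rewrite mule_ge0 ?lee_fin// -lee_fin EFinM nnfun_muleindic_ge0.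
  apply: eq_fsbigr => r _.
  have [r0|r0] := leP 0%R r; last first.
    rewrite preimage_nnfun0// !integral0_eq// => x _.
      by rewrite indic0 mulr0 mul0e.
    by rewrite indic0 mulr0.
  under eq_integral do rewrite EFinM.
  rewrite ge0_integralZl//; last first.
    by apply/measurable_EFinP; apply: measurableT_comp.
  under [RHS]eq_integral do rewrite EFinM -muleA.
  rewrite ge0_integralZl//; last 2 first.
    - apply: emeasurable_funM; apply/measurable_EFinP => //.
      exact: measurableT_comp.
    - by move=> y _; rewrite mule_ge0 ?lee_fin.
  rewrite -H//; congr (_ * _).
  transitivity (\int[m1]_x (\1_(f1 @^-1` (g @^-1` [set r])) x)%:E) => //.
  rewrite integral_indic ?setIT//.
  by rewrite -[X in measurable X]setTI; exact: mf1.
have cvgG t : limn (fun n => (g_ n t)%:E) = G t.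
  by apply/cvg_lim => //; exact: cvg_nnsfun_approx.
have nd t a b : (a <= b)%N -> (g_ a t)%:E <= (g_ b t)%:E.
  by move=> ab; rewrite lee_fin; exact/lefP/nd_nnsfun_approx.
transitivity (limn (fun n => \int[m1]_x (g_ n (f1 x))%:E)).
  rewrite -monotone_convergence//.
  - by apply: eq_integral => x _; rewrite cvgG.
  - by move=> n; apply/measurable_EFinP; apply: measurableT_comp.
  - by move=> n x _; rewrite lee_fin.
  - by move=> x _ a b; exact: nd.
transitivity (limn (fun n => \int[m2]_y ((g_ n (f2 y))%:E * (h y)%:E))).
  by apply: congr_lim; apply/funext => n; exact: key.
rewrite -monotone_convergence//.
- apply: eq_integral => y _.
  by apply: cvg_lim => //; apply: cvgeZr => //; exact: cvg_nnsfun_approx.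
- move=> n; apply: emeasurable_funM; apply/measurable_EFinP => //.
  exact: measurableT_comp.
- by move=> n y _; rewrite mule_ge0 ?lee_fin.
- by move=> y _ a b ab; rewrite lee_wpmul2r ?lee_fin//; exact: nd.
Qed.

Lemma cond_density_integral d (Omega : measurableType d) (R : realType)
  (P : probability Omega R) dX (TX : measurableType dX) dY (TY : measurableType dY)
  (mu : {sigma_finite_measure set TX -> \bar R}) (D : set TX)
  (X : Omega -> TX) (Y : Omega -> TY) (p : TX -> TY -> R) :
  measurable_fun [set: Omega] X -> measurable_fun [set: Omega] Y -> measurable D -> cond_density P mu D X Y p ->
  forall G : TX * TY -> \bar R, measurable_fun [set: TX * TY] G -> (forall u, 0 <= G u) ->
  \int[P]_w G (X w, Y w) = \int[P]_w \int[mu]_(x in D) (G (x, Y w) * (p x (Y w))%:E).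
Proof.
move=> mX mY mD [mp p0 HS] G mG G0.
pose f1 w := (X w, Y w).
pose f2 (u : TX * Omega) := (u.1, Y u.2).
pose h (u : TX * Omega) : R := (\1_D u.1 * p u.1 (Y u.2))%R.
have mf2 : measurable_fun [set: TX * Omega] f2.
  by apply: measurable_fun_pair => //; apply: measurableT_comp.
have mh : measurable_fun [set: TX * Omega] h.
  apply: measurable_funM; first by apply: measurableT_comp.
  exact: (measurableT_comp mp mf2).
have h0 u : (0 <= h u)%R by rewrite mulr_ge0.
have mK (K : TX * TY -> \bar R) : measurable_fun [set: TX * TY] K ->
    measurable_fun [set: TX * Omega] (fun u => K (f2 u) * (h u)%:E).
  move=> mK; apply: emeasurable_funM; last exact/measurable_EFinP.
  exact: measurableT_comp mK mf2.
have tonelli (K : TX * TY -> \bar R) : measurable_fun [set: TX * TY] K ->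
    (forall u, 0 <= K u) ->
    \int[mu \x P]_u (K (f2 u) * (h u)%:E) =
    \int[P]_w \int[mu]_(x in D) (K (x, Y w) * (p x (Y w))%:E).
  move=> mK1 K0; rewrite fubini_tonelli2; last 2 first.
    exact: mK.
    by move=> u; rewrite mule_ge0 ?lee_fin.
  apply: eq_integral => w _; rewrite /fubini_G [RHS]integral_mkcond.
  apply: eq_integral => x _; rewrite /f2 /h /= patchE indicE.
  by case: ifPn => xD; rewrite ?mul1r// mul0r mule0.
rewrite -tonelli//; apply: (@ge0_integral_transport _ _ _ _ _ _ _ P (mu \x P)%E f1 f2 h) => //.
- exact: measurable_fun_pair.
- move=> S mS.
  have m1 : measurable_fun [set: TX * TY] (fun u => (\1_S u : R)%:E).
    by apply/measurable_EFinP.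
  rewrite (tonelli _ m1)//.
  rewrite -[LHS]/(P [set w | S (X w, Y w)]) HS//.
  apply: eq_integral => w _.
  rewrite [LHS]integral_mkcond [RHS]integral_mkcond.
  apply: eq_integral => x _; rewrite !patchE indicE.
  have [xD|xD] := boolP (x \in D); last first.
    rewrite ifF//; apply/negP => /set_mem[/= Dx _].
    by move/negP: xD; apply; exact/mem_set.
  have [xS|xS] := boolP ((x, Y w) \in S); last first.
    rewrite mul0e ifF//; apply/negP => /set_mem[/= _ Sx].
    by move/negP: xS; apply; exact/mem_set.
  rewrite mul1e ifT//; apply/mem_set; split; exact/set_mem.
Qed.

Section derived_conditional_densities.
Context d (Omega : measurableType d) (R : realType) (P : probability Omega R).
Context dZ (TZ : measurableType dZ) dL (TL : measurableType dL).
Variables (A : {RV P >-> R}) (Z : {RV P >-> TZ}) (L : {RV P >-> TL}).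
Variables (nu : {sigma_finite_measure set TZ -> \bar R}) (calZ : set TZ).
Variables (pA_ZL : R -> TZ * TL -> R) (pZ_L : TZ -> TL -> R).
Hypothesis mcalZ : measurable calZ.
Hypothesis dA : cond_density P (@lebesgue_measure R) [set: R] A (fun w => (Z w, L w)) pA_ZL.
Hypothesis dZL : cond_density P nu calZ Z L pZ_L.

Local Notation leb := (@lebesgue_measure R).
Let j a z l : R := (pA_ZL a (z, l) * pZ_L z l)%R.
Let K (G : R * (TZ * TL) -> \bar R) (al : R * TL) : \bar R :=
  \int[nu]_(z in calZ) (G (al.1, (z, al.2)) * (j al.1 z al.2)%:E).

Let mA : measurable_fun [set: Omega] A. Proof. exact: measurable_funPT. Qed.
Let mZ : measurable_fun [set: Omega] Z. Proof. exact: measurable_funPT. Qed.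
Let mL : measurable_fun [set: Omega] L. Proof. exact: measurable_funPT. Qed.

Let j0 a z l : (0 <= j a z l)%R.
Proof. by case: dA dZL => _ + _ [_ + _] => p0 q0; rewrite mulr_ge0. Qed.

Let j10 a z l : (0 <= j a z l * \1_calZ z)%R.
Proof. by rewrite mulr_ge0// j0. Qed.

Let mj : measurable_fun [set: R * TL * TZ] (fun u => j u.1.1 u.2 u.1.2).
Proof.
case: dA dZL => mp _ _ [mq _ _].
apply: measurable_funM.
- apply: (measurableT_comp mp (g := fun u : R * TL * TZ => (u.1.1, (u.2, u.1.2)))).
  apply: measurable_fun_pair; first by apply: measurableT_comp.
  by apply: measurable_fun_pair => //; apply: measurableT_comp.
- apply: (measurableT_comp mq (g := fun u : R * TL * TZ => (u.2, u.1.2))).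
  by apply: measurable_fun_pair => //; apply: measurableT_comp.
Qed.

Let KE G al : K G al = \int[nu]_z (G (al.1, (z, al.2)) * (j al.1 z al.2 * \1_calZ z)%:E).
Proof.
rewrite /K integral_mkcond; apply: eq_integral => z _.
by rewrite patchE indicE; case: ifP; rewrite ?mulr1// mulr0 mule0.
Qed.

Let mG3 (G : R * (TZ * TL) -> \bar R) : measurable_fun [set: R * (TZ * TL)] G ->
  measurable_fun [set: R * TL * TZ]
    (fun u => G (u.1.1, (u.2, u.1.2)) * (j u.1.1 u.2 u.1.2 * \1_calZ u.2)%:E).
Proof.
move=> mG; apply: emeasurable_funM.
- apply: (measurableT_comp mG (g := fun u : R * TL * TZ => (u.1.1, (u.2, u.1.2)))).
  apply: measurable_fun_pair; first by apply: measurableT_comp.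
  by apply: measurable_fun_pair => //; apply: measurableT_comp.
- apply/measurable_EFinP; apply: measurable_funM => //.
  exact: measurableT_comp.
Qed.

Let mK G : measurable_fun [set: R * (TZ * TL)] G -> (forall u, 0 <= G u) ->
  measurable_fun [set: R * TL] (K G).
Proof.
move=> mG G0; rewrite (_ : K G = fubini_F nu
  (fun u : R * TL * TZ => G (u.1.1, (u.2, u.1.2)) * (j u.1.1 u.2 u.1.2 * \1_calZ u.2)%:E)).
  apply: (measurable_fun_fubini_tonelli_F _ (mG3 mG)) => u.
  by rewrite mule_ge0 ?lee_fin ?j10.
by apply/funext => al; rewrite KE.
Qed.

Let J G : measurable_fun [set: R * (TZ * TL)] G -> (forall u, 0 <= G u) ->
  \int[P]_w G (A w, (Z w, L w)) = \int[P]_w \int[leb]_a K G (a, L w).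
Proof.
move=> mG G0.
have mZL : measurable_fun [set: Omega] (fun w => (Z w, L w)).
  exact: measurable_fun_pair.
rewrite (cond_density_integral _ mZL _ dA mG)//.
have [mp p0 _] := dA; have [mq q0 _] := dZL.
pose g u := G u * (pA_ZL u.1 u.2)%:E.
have mg : measurable_fun [set: R * (TZ * TL)] g.
  by apply: emeasurable_funM => //; exact/measurable_EFinP.
have g0 u : 0 <= g u by rewrite mule_ge0 ?lee_fin.
pose F zl := \int[leb]_a g (a, zl).
have mF : measurable_fun [set: TZ * TL] F.
  exact: (@measurable_fun_fubini_tonelli_G _ _ _ _ R leb g mg g0).
rewrite -[LHS]/(\int[P]_w F (Z w, L w)).
have F0 u : 0 <= F u by apply: integral_ge0 => a _; exact: g0.
rewrite (cond_density_integral _ _ _ dZL mF)//.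
apply: eq_integral => w _.
transitivity (\int[nu]_z \int[leb]_a
   (G (a, (z, L w)) * (j a z (L w) * \1_calZ z)%:E)).
  rewrite integral_mkcond; apply: eq_integral => z _.
  rewrite patchE indicE; case: ifP => _; last first.
    by rewrite integral0_eq// => a _; rewrite mulr0 mule0.
  rewrite -ge0_integralZr//.
  - by apply: eq_integral => a _; rewrite mulr1 EFinM muleA.
  - exact: (measurableT_comp mg (pair2_measurable _)).
  - by rewrite lee_fin.
pose H (u : R * TZ) := G (u.1, (u.2, L w)) * (j u.1 u.2 (L w) * \1_calZ u.2)%:E.
rewrite -[LHS]/(\int[nu]_z \int[leb]_a H (a, z)) -fubini_tonelli.
- by apply: eq_integral => a _; rewrite KE.
- apply: (measurableT_comp (mG3 mG) (g := fun u : R * TZ => (u.1, L w, u.2))).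
  by apply: measurable_fun_pair => //; apply: measurable_fun_pair.
- by move=> u; rewrite mule_ge0 ?lee_fin ?j10.
Qed.

Let mAL : measurable_fun [set: R * Omega] (fun u => (u.1, L u.2)).
Proof. by apply: measurable_fun_pair => //; apply: measurableT_comp. Qed.

Let J2 (F : R * TL -> \bar R) : measurable_fun [set: R * TL] F -> (forall u, 0 <= F u) ->
  \int[P]_w \int[leb]_a F (a, L w) = \int[leb \x P]_u F (u.1, L u.2).
Proof.
move=> mF F0; rewrite fubini_tonelli2//.
exact: (measurableT_comp mF mAL).
Qed.

Let I := K (cst 1).
Let I0 u : 0 <= I u.
Proof. by apply: integral_ge0 => z _; rewrite mul1e lee_fin. Qed.
Let mI : measurable_fun [set: R * TL] I.
Proof. exact: mK. Qed.

Let pA_LE a l : pA_L nu calZ pA_ZL pZ_L a l = fine (I (a, l)).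
Proof.
rewrite /pA_L /Rintegral /I /K; congr fine.
by apply: eq_integral => z _; rewrite mul1e.
Qed.

Let Ifin : {ae (leb \x P)%E, forall u, I (u.1, L u.2) \is a fin_num}.
Proof.
have : (leb \x P)%E.-integrable setT (fun u => I (u.1, L u.2)).
  apply/integrableP; split; first exact: (measurableT_comp mI mAL).
  under eq_integral do rewrite gee0_abs//.
  rewrite -(J2 mI)// -J// integral_cst// mul1e.
  by rewrite [X in X < _]probability_setT ltry.
by move=> /(integrable_ae measurableT); apply: filterS => u; apply.
Qed.

Let mpA_L : measurable_fun [set: R * TL] (fun u => pA_L nu calZ pA_ZL pZ_L u.1 u.2).
Proof.
rewrite (_ : (fun _ => _) = fine \o I); first exact: measurableT_comp.
by apply/funext => -[a l]; rewrite pA_LE.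
Qed.

Lemma cond_density_A_L :
  cond_density P (@lebesgue_measure R) [set: R] A L (pA_L nu calZ pA_ZL pZ_L).
Proof.
split=> //; first by move=> a l; rewrite pA_LE fine_ge0.
move=> S mS.
pose G (u : R * (TZ * TL)) : \bar R := (\1_S (u.1, u.2.2) : R)%:E.
have mS1 : measurable_fun [set: R * (TZ * TL)] (fun u => (u.1, u.2.2)).
  by apply: measurable_fun_pair => //; apply: measurableT_comp.
have m1S : measurable_fun [set: R * TL] (\1_S : _ -> R) by [].
have mG : measurable_fun [set: R * (TZ * TL)] G.
  by apply/measurable_EFinP; exact: (measurableT_comp m1S mS1).
have G0 u : 0 <= G u by rewrite lee_fin.
pose F1 (u : R * TL) := (\1_S u : R)%:E * I u.
pose F2 (u : R * TL) : \bar R := (\1_S u * pA_L nu calZ pA_ZL pZ_L u.1 u.2)%:E.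
have mF1 : measurable_fun [set: R * TL] F1.
  by apply: emeasurable_funM => //; exact/measurable_EFinP.
have mF2 : measurable_fun [set: R * TL] F2.
  by apply/measurable_EFinP; exact: measurable_funM.
have F10 u : 0 <= F1 u by rewrite mule_ge0 ?lee_fin.
have F20 u : 0 <= F2 u by rewrite lee_fin mulr_ge0// pA_LE fine_ge0.
transitivity (\int[P]_w G (A w, (Z w, L w))).
  rewrite /G /= -[RHS]/(\int[P]_w (\1_[set w | S (A w, L w)] w)%:E).
  rewrite integral_indic ?setIT// -[X in measurable X]setTI.
  exact: (measurable_fun_pair mA mL).
rewrite J//; transitivity (\int[P]_w \int[leb]_a F1 (a, L w)).
  apply: eq_integral => w _; apply: eq_integral => a _.
  rewrite /F1 /K /I /K /G /= -ge0_integralZl//.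
  - by apply: eq_integral => z _; rewrite mul1e.
  - apply: emeasurable_funM => //; apply/measurable_EFinP/measurable_funTS.
    exact: (measurableT_comp mj (pair1_measurable (a, L w))).
  - by move=> z _; rewrite mul1e lee_fin.
transitivity (\int[P]_w \int[leb]_a F2 (a, L w)); last first.
  apply: eq_integral => w _; rewrite [RHS]integral_mkcond.
  apply: eq_integral => a _; rewrite /F2 patchE indicE /=.
  have [aS|aS] := boolP ((a, L w) \in S).
    by rewrite mul1r ifT//; apply/mem_set; split => //; exact/set_mem.
  rewrite mul0r ifF//; apply/negP => /set_mem[_ /mem_set aS'].
  by rewrite aS' in aS.
rewrite !J2//; apply: ge0_ae_eq_integral => //.
- exact: (measurableT_comp mF1 mAL).
- exact: (measurableT_comp mF2 mAL).
- apply: filterS Ifin; first exact: (ae_filter_ringOfSetsType (leb \x P)).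
  move=> u fu _; rewrite /F1 /F2 /=.
  by rewrite EFinM pA_LE fineK.
Qed.

Lemma cond_density_Z_AL :
  cond_density P nu calZ Z (fun w => (A w, L w)) (pZ_AL nu calZ pA_ZL pZ_L).
Proof.
have mpZ : measurable_fun [set: TZ * (R * TL)]
    (fun u => pZ_AL nu calZ pA_ZL pZ_L u.1 u.2).
  have sw : measurable_fun [set: TZ * (R * TL)] (fun u => (u.2, u.1)).
    exact: measurable_fun_pair.
  have m2 : measurable_fun [set: TZ * (R * TL)]
      (fun u => pA_L nu calZ pA_ZL pZ_L u.2.1 u.2.2).
    exact: (measurableT_comp mpA_L measurable_snd).
  apply: measurable_funM.
    exact: (measurableT_comp mj sw).
  rewrite (_ : (fun _ => _) = (fun u : TZ * (R * TL) =>
      pA_L nu calZ pA_ZL pZ_L u.2.1 u.2.2 `^ (-1))%R).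
    exact: (measurableT_comp (measurable_powR (-1)%R) m2).
  by apply/funext => u; rewrite powR_inv1// pA_LE fine_ge0.
have pZ0 z al : (0 <= pZ_AL nu calZ pA_ZL pZ_L z al)%R.
  by rewrite /pZ_AL mulr_ge0 ?invr_ge0 ?pA_LE ?fine_ge0//; exact: j0.
split => // S mS.
pose G (u : R * (TZ * TL)) : \bar R := (\1_S (u.2.1, (u.1, u.2.2)) : R)%:E.
have m1S : measurable_fun [set: TZ * (R * TL)] (\1_S : _ -> R) by [].
have mG : measurable_fun [set: R * (TZ * TL)] G.
  apply/measurable_EFinP.
  apply: (measurableT_comp m1S (g := fun u : R * (TZ * TL) => (u.2.1, (u.1, u.2.2)))).
  apply: measurable_fun_pair; first by apply: measurableT_comp.
  by apply: measurable_fun_pair => //; apply: measurableT_comp.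
have G0 u : 0 <= G u by rewrite lee_fin.
pose g (u : R * TL * TZ) : \bar R :=
  (\1_S (u.2, u.1) * \1_calZ u.2 * pZ_AL nu calZ pA_ZL pZ_L u.2 u.1)%:E.
have g0 u : 0 <= g u by rewrite lee_fin mulr_ge0// mulr_ge0.
have mg : measurable_fun [set: R * TL * TZ] g.
  have sw : measurable_fun [set: R * TL * TZ] (fun u => (u.2, u.1)).
    exact: measurable_fun_pair.
  apply/measurable_EFinP; apply: measurable_funM.
    apply: measurable_funM; first exact: (measurableT_comp m1S sw).
    by apply: measurableT_comp.
  exact: (measurableT_comp mpZ sw).
pose H (al : R * TL) := \int[nu]_z g (al, z).
have mH : measurable_fun [set: R * TL] H.
  exact: (@measurable_fun_fubini_tonelli_F _ _ _ _ R nu g mg g0).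
have H0 u : 0 <= H u by apply: integral_ge0 => z _; exact: g0.
transitivity (\int[P]_w G (A w, (Z w, L w))).
  rewrite /G /= -[RHS]/(\int[P]_w (\1_[set w | S (Z w, (A w, L w))] w)%:E).
  rewrite integral_indic ?setIT// -[X in measurable X]setTI.
  exact: (measurable_fun_pair mZ (measurable_fun_pair mA mL)).
transitivity (\int[P]_w H (A w, L w)); last first.
  apply: eq_integral => w _; rewrite [RHS]integral_mkcond.
  apply: eq_integral => z _; rewrite /g patchE !indicE /=.
  have [zS|zS] := boolP ((z, (A w, L w)) \in S); last first.
    rewrite !mul0r ifF//; apply/negP => /set_mem[_ /mem_set zS'].
    by rewrite zS' in zS.
  rewrite mul1r; have [zc|zc] := boolP (z \in calZ).
    by rewrite mul1r ifT//; apply/mem_set; split; exact/set_mem.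
  rewrite mul0r ifF//; apply/negP => /set_mem[/mem_set zc' _].
  by rewrite zc' in zc.
rewrite J// (cond_density_integral _ _ _ cond_density_A_L mH)//.
pose F2 (u : R * TL) := H u * (pA_L nu calZ pA_ZL pZ_L u.1 u.2)%:E.
rewrite -[RHS]/(\int[P]_w \int[leb]_a F2 (a, L w)).
have mF2 : measurable_fun [set: R * TL] F2.
  by apply: emeasurable_funM => //; exact/measurable_EFinP.
have pA0 u : (0 <= pA_L nu calZ pA_ZL pZ_L u.1 u.2)%R by rewrite pA_LE fine_ge0.
have F20 u : 0 <= F2 u by rewrite mule_ge0// lee_fin.
have mKG := mK mG G0.
have KG0 u : 0 <= K G u.
  by apply: integral_ge0 => z _; rewrite mule_ge0 ?lee_fin ?j0.
rewrite !J2//; apply: ge0_ae_eq_integral => //.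
- exact: (measurableT_comp mKG mAL).
- exact: (measurableT_comp mF2 mAL).
apply: filterS Ifin; first exact: (ae_filter_ringOfSetsType (leb \x P)).
move=> -[a w] /= fu _; rewrite /F2 /=; set l := L w in fu *.
have mgz : measurable_fun [set: TZ] (fun z => g (a, l, z)).
  exact: (measurableT_comp mg (pair1_measurable (a, l))).
rewrite /H -ge0_integralZr//; last by rewrite lee_fin (pA0 (a, l)).
have [p0|p0] := eqVneq (pA_L nu calZ pA_ZL pZ_L a l) 0%R; last first.
  rewrite KE; apply: eq_integral => z _; rewrite /G /g /= -!EFinM.
  rewrite /pZ_AL /= -/(j a z l); congr (_%:E).
  by rewrite -[RHS]mulrA divfK// [RHS]mulrAC -[RHS]mulrA.
under [RHS]eq_integral do rewrite p0 mule0.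
rewrite integral0.
have I0' : I (a, l) = 0 by rewrite -(fineK fu) -pA_LE p0.
apply/eqP; rewrite eq_le KG0 andbT -I0'.
have mjz : measurable_fun [set: TZ] (fun z => j a z l).
  exact: (measurableT_comp mj (pair1_measurable (a, l))).
apply: ge0_le_integral => //.
- by move=> z _; rewrite mule_ge0 ?lee_fin ?j0.
- apply: measurable_funTS; apply: emeasurable_funM; last exact/measurable_EFinP.
  apply: (measurableT_comp mG (g := fun z => (a, (z, l)))).
  by apply: measurable_fun_pair => //; exact: measurable_fun_pair.
- by apply: measurable_funTS; apply: emeasurable_funM => //; exact/measurable_EFinP.
- move=> z _; apply: lee_wpmul2r; first by rewrite lee_fin j0.
  by rewrite lee_fin indicE; case: (_ \in _).
Qed.
End derived_conditional_densities.

(* Main.v *)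
(** For the weighting function [pi_a = p(a | Z, L) / p(a | L)], Bayes' rule gives
    [p(z | a, L) / p(z | L) = pi_a(z, L)], whence [E(pi_a | L) = 1] and
    [E(pi_a | A = a, L) = E(pi_a^2 | L)]. Therefore [kappa_{pi_a}(a, L)] is
    exactly the chi-squared divergence of the relevance assumption, so it is
    at least [eps2(a)] almost surely. Equicontinuity keeps it above [eps2(a) / 2]
    on an interval around [a], and compactness extracts a finite cover. *)

Require Import Defs.
From HB Require Import structures.
From mathcomp Require Import all_boot all_order all_algebra.
From mathcomp Require Import all_classical all_reals all_analysis.
From mathcomp Require Import finmap measurable_realfun ring lra.

Set Implicit Arguments.
Unset Strict Implicit.
Unset Printing Implicit Defensive.

Import Order.TTheory GRing.Theory Num.Theory.
Import numFieldNormedType.Exports.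

Local Open Scope classical_set_scope.
Local Open Scope ring_scope.

(** * Conditional densities: total mass and almost sure events *)

Lemma measurable_cond_integral (R : realType)
    dX (TX : measurableType dX) dY (TY : measurableType dY)
    (mu : {sigma_finite_measure set TX -> \bar R}) (D : set TX) (g : TX * TY -> R) :
  measurable D -> measurable_fun [set: TX * TY] g -> (forall u, 0 <= g u) ->
  measurable_fun [set: TY] (fun y => \int[mu]_(x in D) (g (x, y))%:E)%E.
Proof.
move=> mD mg g0.
rewrite (_ : (fun _ => _) =
    fubini_G mu (fun u : TX * TY => (\1_D u.1 * g u)%:E)); last first.
  apply/funext => y; rewrite /fubini_G [LHS]integral_mkcond.
  apply: eq_integral => x _; rewrite patchE indicE /=.
  by case: ifP; rewrite ?mul1r ?mul0r.
apply: measurable_fun_fubini_tonelli_G.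
- by apply/measurable_EFinP; apply: measurable_funM => //; apply: measurableT_comp.
- by move=> u; rewrite lee_fin mulr_ge0.
Qed.

Section cond_density.
Context d (Omega : measurableType d) (R : realType) (P : probability Omega R).
Context dX (TX : measurableType dX) dY (TY : measurableType dY).
Variables (mu : {sigma_finite_measure set TX -> \bar R}) (D : set TX).
Variables (X : Omega -> TX) (Y : {RV P >-> TY}) (p : TX -> TY -> R).
Hypothesis mX : measurable_fun [set: Omega] X.
Hypothesis mD : measurable D.
Hypothesis pP : cond_density P mu D X Y p.

Let mY : measurable_fun [set: Omega] Y. Proof. exact: measurable_funPT. Qed.

(** The mass of [p] at [y] and the constant 1 have the same integral over every measurable set under
    the law of [Y], by the disintegration applied to events on [Y] alone; hence they agree almost
    everywhere. *)
Lemma cond_density_mass :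
  {ae P, forall w, (\int[mu]_(x in D) (p x (Y w))%:E = 1)%E}.
Proof.
have [mp p0 _] := pP.
pose I y := (\int[mu]_(x in D) (p x y)%:E)%E.
have mI : measurable_fun [set: TY] I.
  exact: (measurable_cond_integral mu mD (g := fun u => p u.1 u.2)).
have I0 y : (0 <= I y)%E by apply: integral_ge0 => x _; rewrite lee_fin.
pose mu' := distribution P Y.
have intE E : measurable E -> (\int[mu']_(y in E) 1 = \int[mu']_(y in E) I y)%E.
  move=> mE.
  rewrite /mu' /distribution !ge0_integral_pushforward//; last exact: measurable_funTS.
  rewrite [LHS]integral_mkcond [RHS]integral_mkcond.
  pose G (u : TX * TY) : \bar R := (\1_E u.2 : R)%:E.
  have mG : measurable_fun [set: TX * TY] G.
    by apply/measurable_EFinP; apply: measurableT_comp.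
  have := cond_density_integral mX mY mD pP mG.
  rewrite /G /= => H; transitivity (\int[P]_w (\1_E (Y w))%:E)%E.
    apply: eq_integral => w _; rewrite patchE indicE /= -[w \in _]/(Y w \in E).
    by case: ifP.
  rewrite H; last by move=> u; rewrite lee_fin.
  apply: eq_integral => w _; rewrite patchE indicE /= -[w \in _]/(Y w \in E).
  case: ifP => _.
    by apply: eq_integral => x _; rewrite mul1e.
  by rewrite integral0_eq// => x _; rewrite mul0e.
have : ae_eq mu' [set: TY] (cst 1%E) I.
  apply: integral_ae_eq => //.
  - exact: finite_measure_integrable_cst.
  - by move=> E _ mE; exact: intE.
(* A null set for the law of [Y] pulls back along [Y] to a [P]-null event. *)
move=> [N [mN N0 HN]]; exists (Y @^-1` N); split.
- by rewrite -[X in measurable X]setTI; exact: mY.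
- exact: N0.
- move=> w /= nw; apply: HN => /= H; apply: nw.
  by rewrite -[LHS]/(I (Y w)) -(H Logic.I).
Qed.

(** The integral of [p] over the complement of [S] has expectation equal to the probability that [S]
    fails, which is 0. So that integral vanishes almost surely, and then its nonnegative integrand
    vanishes almost everywhere. Points where [p] is 0 are excepted because the joint law does not
    see them. *)
Lemma cond_density_ae (S : set (TX * TY)) : measurable S ->
  {ae P, forall w, S (X w, Y w)} ->
  {ae P, forall w, {ae mu, forall x, D x -> p x (Y w) != 0 -> S (x, Y w)}}.
Proof.
move=> mS Sae; have [mp p0 _] := pP.
have mS' : measurable_fun [set: TX * TY] (\1_(~` S) : _ -> R).
  by apply: measurable_indic; exact: measurableC.
pose g (u : TX * TY) : R := \1_(~` S) u * p u.1 u.2.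
have mg : measurable_fun [set: TX * TY] g by exact: measurable_funM.
have g0 u : 0 <= g u by rewrite mulr_ge0.
pose F y := (\int[mu]_(x in D) (g (x, y))%:E)%E.
have mF : measurable_fun [set: TY] F by exact: (measurable_cond_integral mu mD mg g0).
have mFY : measurable_fun [set: Omega] (F \o Y) by exact: measurableT_comp.
have F0 y : (0 <= F y)%E by apply: integral_ge0 => x _; rewrite lee_fin.
have : (\int[P]_w `|(F \o Y) w|)%E = 0%E.
  transitivity (\int[P]_w F (Y w))%E.
    by apply: eq_integral => w _; rewrite gee0_abs//=.
  transitivity (\int[P]_w (\1_(~` S) (X w, Y w))%:E)%E.
    have mG : measurable_fun [set: TX * TY] (fun u => (\1_(~` S) u : R)%:E).
      exact/measurable_EFinP.
    by rewrite (cond_density_integral mX mY mD pP mG).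
  rewrite (ae_eq_integral (cst 0%E)) ?integral0//.
  - apply/measurable_EFinP; apply: (measurableT_comp mS' (g := fun w => (X w, Y w))).
    exact: measurable_fun_pair.
  - apply: filterS Sae => w Sw _; rewrite indicE /=.
    by rewrite memNset//; apply/not_not.
move/(ae_eq_integral_abs P measurableT mFY).
apply: filterS => w /(_ Logic.I) /= Fw.
have mgw : measurable_fun D (fun x => (g (x, Y w))%:E).
  apply/measurable_EFinP/measurable_funTS.
  exact: (measurableT_comp mg (pair2_measurable _)).
have : (\int[mu]_(x in D) `|(g (x, Y w))%:E|)%E = 0%E.
  by rewrite -Fw; apply: eq_integral => x _; rewrite gee0_abs// lee_fin.
move/(ae_eq_integral_abs mu mD mgw).
apply: filterS => x gx Dx px; have /= [] := gx Dx => /eqP.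
rewrite mulf_eq0 (negbTE px) orbF indicE.
have [//|nS] := pselect (S (x, Y w)).
by rewrite mem_set//= oner_eq0.
Qed.

End cond_density.

(** * The chi-squared divergence of a tilted density *)

(** Domination by [|M| * q]. The bound on [f] is asked only where [q] is nonzero, which is all that
    [cond_density_ae] provides. *)
Lemma integrable_ae_bounded_mul d (T : measurableType d) (R : realType)
    (mu : {measure set T -> \bar R}) (D : set T) (f q : T -> R) (M : R) :
  measurable D -> measurable_fun D f -> (forall x, 0 <= q x) ->
  mu.-integrable D (EFin \o q) ->
  {ae mu, forall x, D x -> q x != 0 -> `|f x| <= M} ->
  mu.-integrable D (EFin \o (fun x => f x * q x)).
Proof.
move=> mD mf q0 iq fM.
have mq : measurable_fun D q.
  by apply/measurable_EFinP; exact: (measurable_int mu iq).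
have mfq : measurable_fun D (fun x => f x * q x) by exact: measurable_funM.
apply/integrableP; split; first exact/measurable_EFinP.
have iMq : mu.-integrable D (EFin \o (fun x => `|M| * q x)).
  have := integrableZl mD `|M| iq; apply: eq_integrable => // x _.
apply: le_lt_trans (integrable_lty mD iMq).
apply: ae_ge0_le_integral => //.
- by apply/measurable_EFinP; exact: measurableT_comp.
- by move=> x _; rewrite lee_fin mulr_ge0.
- exact: measurable_int iMq.
- apply: filterS fM => x fM Dx; rewrite lee_fin normrM (ger0_norm (q0 x)).
  have [->|qx] := eqVneq (q x) 0; first by rewrite !mulr0.
  by rewrite ler_wpM2r// (le_trans (fM Dx qx))// ler_norm.
Qed.

(* With [u = p / c], the integrand of the divergence is [(u - 1)^2 q], which
   integrates to [E(u^2) - 2 E(u) + 1 = E(u^2) - E(u)] because [E(u) = 1]. *)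
Lemma chi2_tilted_density d (T : measurableType d) (R : realType)
    (mu : {measure set T -> \bar R}) (D : set T) (p q : T -> R) (M : R) :
  measurable D -> measurable_fun D p ->
  measurable_fun D q -> (forall x, 0 <= q x) ->
  (\int[mu]_(x in D) (q x)%:E = 1)%E ->
  {ae mu, forall x, D x -> q x != 0 -> `|p x| <= M} ->
  let c := (\int[mu]_(x in D) (p x * q x))%R in c != 0 ->
  chi2 mu D (fun x => p x * q x / c) q =
  (\int[mu]_(x in D) (p x / c * (p x * q x / c))
   - \int[mu]_(x in D) (p x / c * q x))%:E.
Proof.
move=> mD mp mq q0 q1 pM c c0.
have iq : mu.-integrable D (EFin \o q).
  apply/integrableP; split; first exact/measurable_EFinP.
  under eq_integral do rewrite /= ger0_norm//.
  by rewrite q1 ltry.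
have Rq1 : (\int[mu]_(x in D) q x)%R = 1 by rewrite /Rintegral q1.
have ipq := integrable_ae_bounded_mul mD mp q0 iq pM.
pose u x := p x / c.
have mu_ : measurable_fun D u by exact: measurable_funM.
have uM : {ae mu, forall x, D x -> q x != 0 -> `|u x| <= M / `|c|}.
  apply: filterS pM => x pM Dx qx.
  by rewrite normrM normfV ler_wpM2r ?invr_ge0//; exact: pM.
have iuq := integrable_ae_bounded_mul mD mu_ q0 iq uM.
have u2M : {ae mu, forall x, D x -> q x != 0 -> `|u x ^+ 2| <= (M / `|c|) ^+ 2}.
  apply: filterS uM => x uM Dx qx.
  by rewrite normrX lerXn2r ?nnegrE ?(le_trans _ (uM Dx qx)) ?uM.
have mu2 : measurable_fun D (fun x => u x ^+ 2) by exact: measurable_funX.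
have iu2q := integrable_ae_bounded_mul mD mu2 q0 iq u2M.
have Ru1 : (\int[mu]_(x in D) (u x * q x))%R = 1.
  transitivity (\int[mu]_(x in D) (c^-1 * (p x * q x)))%R.
    by apply: eq_Rintegral => x _; rewrite /u; ring.
  by rewrite RintegralZl// mulVf.
(* The integrand is grouped so that [q - u * q] integrates to [1 - 1 = 0], while
   [u ^+ 2 * q - u * q] gives the claimed difference. *)
have i1 : mu.-integrable D (EFin \o (fun x => u x ^+ 2 * q x - u x * q x)).
  exact: (integrableB mD iu2q iuq).
have i2 : mu.-integrable D (EFin \o (fun x => q x - u x * q x)).
  exact: (integrableB mD iq iuq).
have i3 : mu.-integrable D
    (EFin \o (fun x => (u x ^+ 2 * q x - u x * q x) + (q x - u x * q x))).
  exact: (integrableD mD i1 i2).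
transitivity (\int[mu]_(x in D)
   ((u x ^+ 2 * q x - u x * q x) + (q x - u x * q x))%:E)%E.
  apply: eq_integral => x _; congr (_%:E).
  (* Where [q] is 0 the ratio in [chi2] is a default value, but the factor [q] kills both sides;
     elsewhere the ratio simplifies to [u]. *)
  have [->|qx] := eqVneq (q x) 0; first by rewrite !mulr0 !subr0 addr0.
  by rewrite /u; field; rewrite c0.
rewrite -[LHS]fineK; last exact: (integrable_fin_num mD i3).
congr (_%:E).
rewrite -[LHS]/(\int[mu]_(x in D)
   ((u x ^+ 2 * q x - u x * q x) + (q x - u x * q x)))%R.
rewrite RintegralD// !RintegralB// Rq1 Ru1 subrr addr0; congr (_ - _).
by apply: eq_Rintegral => x _; rewrite /u; ring.
Qed.

(** * The weighting function [pi_]: divergence identity and measurability *)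

Section pi.
Context d (Omega : measurableType d) (R : realType) (P : probability Omega R).
Context dZ (TZ : measurableType dZ) dL (TL : measurableType dL).
Variables (A : {RV P >-> R}) (Z : {RV P >-> TZ}) (L : {RV P >-> TL}).
Variables (nu : {sigma_finite_measure set TZ -> \bar R}) (calZ : set TZ).
Variables (pA_ZL : R -> TZ * TL -> R) (pZ_L : TZ -> TL -> R) (a : R).
Hypothesis mcalZ : measurable calZ.
Hypothesis dA :
  cond_density P lebesgue_measure [set: R] A (fun w => (Z w, L w)) pA_ZL.
Hypothesis dZL : cond_density P nu calZ Z L pZ_L.

(** By Bayes' rule the density of [Z] given [(a, L)] is that of [Z] given [L], tilted by [pA_ZL a]
    and normalised by [pA_L a]. So [chi2_tilted_density] applies at almost every value of [L], and
    its two integrals are the two conditional expectations in [kappa]. *)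
Lemma chi2_kappa_pi (M : R) :
  {ae P, forall w, pA_ZL a (Z w, L w) <= M} ->
  {ae P, forall w, 0 < pA_L nu calZ pA_ZL pZ_L a (L w)} ->
  {ae P, forall w,
    chi2 nu calZ (fun z => pZ_AL nu calZ pA_ZL pZ_L z (a, L w))
      (fun z => pZ_L z (L w)) =
    (kappa nu calZ pA_ZL pZ_L (pi_ nu calZ pA_ZL pZ_L a) a (L w))%:E}.
Proof.
move=> pM pA_gt0; have [mpA pA0 _] := dA; have [mpZ pZ0 _] := dZL.
have mZ : measurable_fun [set: Omega] Z by exact: measurable_funPT.
have mpAa : measurable_fun [set: TZ * TL] (pA_ZL a).
  exact: (measurableT_comp mpA (pair1_measurable a)).
pose S := [set u | pA_ZL a u <= M].
have mS : measurable S.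
  rewrite (_ : S = pA_ZL a @^-1` `]-oo, M]); last first.
    by apply/seteqP; split => u /=; rewrite in_itv.
  by rewrite -[X in measurable X]setTI; apply: mpAa => //; exact: measurable_itv.
(* The bound [M] holds almost surely in [(Z, L)]; it is needed for [nu]-almost every [z] at a fixed
   value of [L]. *)
have bound := cond_density_ae mZ mcalZ dZL mS pM.
have mass := cond_density_mass mZ mcalZ dZL.
apply: filterS3 bound mass pA_gt0 => w bound mass pA_gt0.
apply: (@chi2_tilted_density _ _ _ nu calZ
  (fun z => pA_ZL a (z, L w)) (fun z => pZ_L z (L w)) M) => //.
- exact/measurable_funTS/(measurableT_comp mpAa (pair2_measurable _)).
- exact/measurable_funTS/(measurableT_comp mpZ (pair2_measurable _)).
- apply: filterS bound => z bound Dz qz.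
  by rewrite ger0_norm//; exact: bound.
- exact: lt0r_neq0.
Qed.

Lemma measurable_pi :
  measurable_fun [set: TZ * TL] (pi_ nu calZ pA_ZL pZ_L a).
Proof.
have [mpA _ _] := dA.
have [mpAL pAL0 _] := cond_density_A_L mcalZ dA dZL.
apply: measurable_funM; first exact: (measurableT_comp mpA (pair1_measurable a)).
(* The inverse becomes a measurable real power; the two agree on nonnegative numbers, 0 included. *)
rewrite (_ : (fun _ => _) =
    (fun u : TZ * TL => pA_L nu calZ pA_ZL pZ_L a u.2 `^ (-1))); last first.
  by apply/funext => u; rewrite powR_inv1.
apply: (measurableT_comp (measurable_powR (-1))).
apply: (measurableT_comp (g := snd) _ measurable_snd).
exact: (measurableT_comp mpAL (pair1_measurable a)).
Qed.

End pi.

(** * Compactness and the finite cover *)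

(** Each point of [K] is covered by its own interval, so the centres of a finite subcover stay in
    [K] and keep the properties known there. *)
Lemma compact_openB_cover (R : realType) (K : set R) (h : R -> R) :
  compact K -> (forall a, K a -> 0 < h a) ->
  exists2 s : seq R, (forall a, a \in s -> K a) &
    forall x, K x -> exists2 a, a \in s & openB a (h a) x.
Proof.
rewrite compact_cover => cK h0.
have [|x Kx|s sK Ks] := cK R K (fun a => openB a (h a)).
- by move=> a _; exact: interval_open.
- exists x => //; rewrite /openB /= in_itv /=.
  by have := h0 x Kx; lra.
exists (enum_fset s); first by move=> a /sK /set_mem.
by move=> x /Ks[a /= sa xa]; exists a.
Qed.

Theorem proposition2p6 (R : realType) (d : measure_display)
  (Omega : measurableType d) (P : probability Omega R) (dZ dL : nat)
  (A : {RV P >-> R}) (Z : {RV P >-> (dZ.-tuple R)}) (L : {RV P >-> (dL.-tuple R)})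
  (calZ : set (dZ.-tuple R)) (calL : set (dL.-tuple R))
  (nu : {sigma_finite_measure set (dZ.-tuple R) -> \bar R})
  (pA_ZL : R -> dZ.-tuple R * dL.-tuple R -> R)
  (pZ_L : dZ.-tuple R -> dL.-tuple R -> R)
  (measurable_calZ : measurable calZ) (measurable_calL : measurable calL)
  (Z_in : forall w, calZ (Z w)) (L_in : forall w, calL (L w))
  (density_A_ZL : cond_density P lebesgue_measure [set: R]
     A (fun w => (Z w, L w)) pA_ZL)
  (density_Z_L : cond_density P nu calZ Z L pZ_L)
  (pA_L_gt0 : forall a, interior (law_support A) a ->
     {ae P, forall w, 0 < pA_L nu calZ pA_ZL pZ_L a (L w)})
  (continuity : forall a, interior (law_support A) a ->
     {ae P, forall w, {for a, continuous (fun a' => pA_ZL a' (Z w, L w))}})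
  (boundedness : forall a, interior (law_support A) a ->
     exists M : R, {ae P, forall w, pA_ZL a (Z w, L w) <= M})
  (positivity : forall a, interior (law_support A) a ->
     exists2 eps1 : R, 0 < eps1 &
       {ae P, forall w, eps1 <= pA_L nu calZ pA_ZL pZ_L a (L w)})
  (relevance : forall a, interior (law_support A) a ->
     exists2 eps2 : R, 0 < eps2 &
       {ae P, forall w,
         (eps2%:E <= chi2 nu calZ
                       (fun z => pZ_AL nu calZ pA_ZL pZ_L z (a, L w))
                       (fun z => pZ_L z (L w)))%E})
  (equicontinuity : forall a, interior (law_support A) a ->
     forall eps : R, 0 < eps -> exists2 r0 : R, 0 < r0 &
       forall l a', calL l -> openB a r0 a' ->
         `|kappa nu calZ pA_ZL pZ_L (pi_ nu calZ pA_ZL pZ_L a) a' l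
           - kappa nu calZ pA_ZL pZ_L (pi_ nu calZ pA_ZL pZ_L a) a l| <= eps)
  (Ac : set R) (compact_Ac : compact Ac)
  (Ac_sub : Ac `<=` interior (law_support A)) :
  exists (M : nat) (c h : 'I_M -> R),
    [/\ (forall m, 0 < h m),
        Ac `<=` \bigcup_(m in [set: 'I_M]) openB (c m) (h m) &
        forall m, URWF A Z L nu calZ calL pA_ZL pZ_L (openB (c m) (h m))
                    (pi_ nu calZ pA_ZL pZ_L (c m))].
Proof.
pose S := interior (law_support A).
pose W := pi_ nu calZ pA_ZL pZ_L.
have /choice[h hP] : forall a, exists r, Ac a ->
    0 < r /\ URWF A Z L nu calZ calL pA_ZL pZ_L (openB a r) (W a).
  move=> a.
  have [/Ac_sub Sa|nAa] := pselect (Ac a); last by exists 0.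
  have [M pM] := boundedness a Sa.
  have [e1 e1_gt0 pA_ge] := positivity a Sa.
  have [e2 e2_gt0 chi2_ge] := relevance a Sa.
  (* Half of the relevance bound is given up to equicontinuity; the other half is the regularity
     constant. *)
  have e2'_gt0 : 0 < e2 / 2 by rewrite divr_gt0.
  have [r r_gt0 kappa_near] := equicontinuity a Sa _ e2'_gt0.
  have /nbhs_ballP[r' /= r'_gt0 ballS] : nbhs a S by exact: nbhs_interior.
  (* [r] controls the variation of [kappa], and [r'] keeps the interval inside the interior of the
     support. *)
  exists (Num.min r r') => _; split; first by rewrite lt_min r_gt0.
  have mW : measurable_fun [set: _] (W a).
    exact: (measurable_pi a measurable_calZ density_A_ZL density_Z_L).
  split.
  - move=> a'; rewrite /openB /= in_itv /= => a'_near; apply: ballS.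
    rewrite /ball /= ltr_distlC.
    have : Num.min r r' <= r' by rewrite ge_min lexx orbT.
    by lra.
  - exact: measurable_funTS.
  (* Numerator at most [M] by boundedness, denominator at least [e1] by positivity. *)
  - exists (M / e1); apply: filterS2 pM pA_ge => w pM pA_ge.
    have [_ pA0 _] := density_A_ZL.
    rewrite /W /pi_ normrM normfV !ger0_norm//; last exact: le_trans (ltW e1_gt0) _.
    rewrite ler_pM ?invr_ge0 ?lef_pV2 ?posrE ?(lt_le_trans e1_gt0)//.
    exact: le_trans (ltW e1_gt0) _.
  - exists (e2 / 2) => // a' a'_near.
    have := chi2_kappa_pi measurable_calZ density_A_ZL density_Z_L pM (pA_L_gt0 a Sa).
    apply: filterS2 chi2_ge => w chi2_ge chi2E.
    move: chi2_ge; rewrite chi2E lee_fin => kappa_ge.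
    have : openB a r a'.
      move: a'_near; rewrite /openB /= !in_itv /=.
      have : Num.min r r' <= r by rewrite ge_min lexx.
      by lra.
    (* As [kappa] at [a] is a divergence of at least [e2], its value at [a'] is at least
       [e2 - e2 / 2], hence so is its absolute value. *)
    move=> /(kappa_near _ _ (L_in w)); rewrite -/(W a) ler_norml => /andP[lo _].
    apply: le_trans (ler_norm _); move: kappa_ge lo; rewrite -/(W a); lra.
have [|s sAc Acs] := @compact_openB_cover R Ac h compact_Ac.
  by move=> a /hP[].
(* The cover is indexed by positions in [s], so the default 0 of [nth] is never reached. *)
exists (size s), (fun m => nth 0 s m), (fun m => h (nth 0 s m)).
have sAcm (m : 'I_(size s)) : Ac (nth 0 s m) by apply: sAc; exact: mem_nth.
split.
- by move=> m; have [] := hP _ (sAcm m).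
- move=> x /Acs[a sa xa]; have im : (index a s < size s)%N by rewrite index_mem.
  by exists (Ordinal im) => //=; rewrite nth_index.
- by move=> m; have [] := hP _ (sAcm m).
Qed.
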